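(* Let $(A,\mathcal{A},\mu)$ be a probability measure space and let $E$ be a Banach space. A measurable map $f:A\to E$ is $\mu$-Bochner integrable if and only if the pushforward measure $f_*\mu$ belongs to $\mathcal{P}^1(E)$, and in this case $\int_A f\,d\mu=\beta_E(f_*\mu)$, where $\beta_E$ is the arithmetic barycentric map of $E$.
   Context: Measurable means $f^{-1}(B)\in\mathcal{A}$ for every Borel set $B\subseteq E$; the pushforward is $f_*\mu(B)=\mu(f^{-1}(B))$. Bochner integral: a $\mu$-simple function is $s=\sum_{i=1}^n\chi_{A_i}x_i$ with $A_i\in\mathcal{A}$, $x_i\in E$, and $\int_A s\,d\mu=\sum_i\mu(A_i)x_i$. A function $f:A\to E$ is $\mu$-Bochner integrable if there is a sequence of $\mu$-simple functions $s_n$ with $s_n\to f$ $\mu$-almost everywhere and $\int_A\|f-s_n\|\,d\mu\to0$; then $\int_A f\,d\mu:=\lim_n\int_A s_n\,d\mu$. For a metric space $(X,d)$: the support of a Borel measure $\mu$ is the set of points all of whose open neighbourhoods have positive measure. $\mathcal{P}(X)$ is the set of Borel probability measures on $X$ whose support has measure $1$; $\mathcal{P}^1(X)$ is the set of $\mu\in\mathcal{P}(X)$ with $\int_X d(x,y)\,d\mu(x)<\infty$ for some (hence all) $y\in X$; $\mathcal{P}_0(X)$ is the set of measures $\frac1n\sum_{j=1}^n\delta_{x_j}$, $n\ge 1$, $x_j\in X$ (repetitions allowed). The Wasserstein distance on $\mathcal{P}^1(X)$ is $d_w(\mu,\nu)=\inf_{\pi\in\Pi(\mu,\nu)}\int_{X\times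 X}d(x,y)\,d\pi(x,y)$, where $\Pi(\mu,\nu)\subseteq\mathcal{P}(X\times X)$ is the set of couplings (measures with marginals $\mu$ and $\nu$). $\mathcal{P}_0(X)$ is $d_w$-dense in $\mathcal{P}^1(X)$. A contractive barycentric map on $\mathcal{P}^1(X)$ is a map $\beta:\mathcal{P}^1(X)\to X$ with $\beta(\delta_x)=x$ for all $x$ and $d(\beta(\mu),\beta(\nu))\le d_w(\mu,\nu)$ for all $\mu,\nu$. For a Banach space $E$ with metric $\|x-y\|$, the arithmetic barycentric map $\beta_E:\mathcal{P}^1(E)\to E$ is the unique contractive barycentric map with $\beta_E\big(\frac1n\sum_{i=1}^n\delta_{x_i}\big)=\frac1n\sum_{i=1}^n x_i$ for all $n$ and all $x_1,\dots,x_n\in E$. *)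

(* Defs.v *)
From HB Require Import structures.
From mathcomp Require Import all_boot all_order all_algebra.
From mathcomp Require Import all_classical all_reals all_analysis.

Set Implicit Arguments.
Unset Strict Implicit.
Unset Printing Implicit Defensive.

Import Order.TTheory GRing.Theory Num.Theory.
Import numFieldNormedType.Exports.

Local Open Scope classical_set_scope.
Local Open Scope ring_scope.
Local Open Scope ereal_scope.

(* Missing join instance: it makes [X * X], with the product topology, a
   [ptopologicalType]. *)
HB.instance Definition _ (X Y : ptopologicalType) := Pointed.on (X * Y)%type.

(* [borel (X * X)] is generated by the open sets of the product topology; for a
   non-separable [X] it can be strictly larger than the product sigma-algebra,
   which is the library's default on [borel X * borel X]. *)
Notation borel X := (g_sigma_algebraType (@open X)).

(* A simple function is kept together with a representation; the sets need not
   be disjoint. *)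
Record simple_function (d : measure_display) (T : measurableType d)
    (E : Type) := SimpleFunction {
  sf_size : nat ;
  sf_set : 'I_sf_size -> set T ;
  sf_vec : 'I_sf_size -> E ;
  sf_measurable : forall i, measurable (sf_set i) }.

Arguments sf_set {d T E} s i : rename.
Arguments sf_vec {d T E} s i : rename.
Arguments sf_measurable {d T E} s i : rename.

Section bochner.
Context (R : realType) (d : measure_display) (T : measurableType d)
  (E : normedModType R) (mu : {measure set T -> \bar R}).

Definition sf_fun (s : simple_function T E) (t : T) : E :=
  (\sum_i \1_(sf_set s i) t *: sf_vec s i)%R.

Definition sf_integral (s : simple_function T E) : E :=
  (\sum_i fine (mu (sf_set s i)) *: sf_vec s i)%R.

Definition bochner_approximation (f : T -> E) (s : nat -> simple_function T E) :=
  {ae mu, forall t, sf_fun (s n) t @[n --> \oo] --> f t} /\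
  (\int[mu]_t `|f t - sf_fun (s n) t|%:E) @[n --> \oo] --> 0.

Definition bochner_integrable (f : T -> E) :=
  exists s, bochner_approximation f s.

(* For integrable [f] the limit exists in complete [E] and does not depend on
   the approximating sequence. *)
Definition bochner_integral (f : T -> E) : E :=
  xget 0%R [set v | exists2 s, bochner_approximation f s &
                      sf_integral (s n) @[n --> \oo] --> v].

End bochner.

Section borel_probability.
Context (R : realType) (X : ptopologicalType).

Definition measure_support (mu : probability (borel X) R) : set X :=
  [set x | forall U : set X, open_nbhs x U -> 0 < mu U].

Definition full_support (mu : probability (borel X) R) :=
  mu (measure_support mu) = 1.

(* The measure (1/(n+1)) (delta_(x 0) + ... + delta_(x n)): there are [n.+1]
   atoms, so that the number of atoms is never zero, and only the first [n.+1]
   terms of [x] matter. *)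
Definition uniform_atoms (n : nat) (x : nat -> X) : set (borel X) -> \bar R :=
  mscale (n.+1%:R^-1)%:nng%R (msum (fun j => \d_(x j : borel X)) n.+1).

Let uniform_atoms0 n x : uniform_atoms n x set0 = 0.
Proof. exact: measure0. Qed.

Let uniform_atoms_ge0 n x B : 0 <= uniform_atoms n x B.
Proof. exact: measure_ge0. Qed.

Let uniform_atoms_sigma_additive n x :
  semi_sigma_additive (uniform_atoms n x).
Proof. exact: measure_semi_sigma_additive. Qed.

HB.instance Definition _ n x := isMeasure.Build _ _ _ (uniform_atoms n x)
  (uniform_atoms0 n x) (@uniform_atoms_ge0 n x)
  (@uniform_atoms_sigma_additive n x).

Let uniform_atoms_setT n x : uniform_atoms n x setT = 1.
Proof.
rewrite /uniform_atoms /mscale /= /msum.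
rewrite (eq_bigr (fun=> 1%:E)) => [|i _]; last exact: diracT.
rewrite sumEFin sumr_const card_ord -EFinM mulVf// pnatr_eq0//.
Qed.

HB.instance Definition _ n x := Measure_isProbability.Build _ _ _
  (uniform_atoms n x) (uniform_atoms_setT n x).

End borel_probability.

(* The metric on [E] is [`|x - y|]. *)
Section wasserstein.
Context (R : realType) (E : normedModType R).
Implicit Types mu nu : probability (borel E) R.

Definition P1 mu :=
  full_support mu /\ exists y : E, \int[mu]_x `|(x : E) - y|%:E < +oo.

Definition couplings mu nu : set (probability (borel (E * E)%type) R) :=
  [set p : probability (borel (E * E)%type) R | [/\ full_support p,
     forall B : set (borel E), measurable B -> p [set z | B z.1] = mu B &
     forall B : set (borel E), measurable B -> p [set z | B z.2] = nu B]].

Definition wasserstein mu nu : \bar R :=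
  ereal_inf [set \int[p]_z `|(z : E * E).1 - (z : E * E).2|%:E
            | p in couplings mu nu].

(* A map on [P1] is represented by a function on all Borel probability
   measures whose values outside [P1] are unconstrained; Dirac measures (and
   [uniform_atoms] above) always belong to [P1]. *)
Definition contractive_barycentric (beta : probability (borel E) R -> E) :=
  (forall x : E, beta (\d_(x : borel E)) = x) /\
  (forall mu nu, P1 mu -> P1 nu ->
     `|beta mu - beta nu|%:E <= wasserstein mu nu).

Definition arithmetic_barycentric (beta : probability (borel E) R -> E) :=
  contractive_barycentric beta /\
  forall n (x : nat -> E),
    beta (uniform_atoms R n x) = (n.+1%:R^-1 *: \sum_(j < n.+1) x j)%R.

(* For complete [E] such a map exists and is unique on [P1]. *)
Definition arithmetic_barycenter : probability (borel E) R -> E :=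
  xget (fun=> 0%R) [set beta | arithmetic_barycentric beta].

End wasserstein.

(* Main.v *)
Require Import Defs.
From HB Require Import structures.
From mathcomp Require Import all_boot all_order all_algebra.
From mathcomp Require Import all_classical all_reals all_analysis.
From mathcomp Require Import measurable_realfun lra.

(* If [f] is Bochner integrable it takes values a.e. in the closure of a
   countable set, which forces the support of [f_* mu] to have full measure.
   Conversely the support of a finite Borel measure is separable, so if
   [nu = f_* mu] is in [P1] then the identity of [E] is approximated by the
   simple functions sending a point to the nearest of the first [n] points of a
   dense sequence, and these are pulled back along [f].
   Integrals of simple functions being 1-Lipschitz for the L1 distance,
   [nu |-> \int x dnu] is a contractive arithmetic barycentric map.  Such a map
   is unique on [P1] because uniform atomic measures are Wasserstein dense: [nu]
   is close to its image under a simple function, whose finitely many weights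
   are then rounded down to multiples of [1/n], the excess being moved to [0]. *)

Set Implicit Arguments.
Unset Strict Implicit.
Unset Printing Implicit Defensive.

Import Order.TTheory GRing.Theory Num.Theory.
Import numFieldNormedType.Exports.

Local Open Scope classical_set_scope.
Local Open Scope ring_scope.
Local Open Scope ereal_scope.

(** * Borel sets of normed spaces, supports and separability *)

Section borel_sets.
Context (R : realType).

Lemma probability_negligibleC d (T : measurableType d)
    (mu : probability T R) (A : set T) :
  measurable A -> mu.-negligible (~` A) -> mu A = 1.
Proof.
move=> mA nA; have /eqP : mu (~` A) = 0.
  by apply: measure_negligible => //; exact: measurableC.
rewrite probability_setC//.
have mufin : mu A \is a fin_num by exact: fin_num_measure.
by rewrite sube_eq ?fin_num_adde_defl// add0e => /eqP ->.
Qed.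

Lemma negligible_setC1 d (T : measurableType d)
    (mu : probability T R) (A : set T) :
  measurable A -> mu A = 1 -> mu.-negligible (~` A).
Proof.
move=> mA muA; exists (~` A); split => //; first exact: measurableC.
by rewrite probability_setC// muA subee.
Qed.

Implicit Types X Y : normedModType R.

Lemma open_borel X (U : set X) : open U -> measurable (U : set (borel X)).
Proof. by move=> oU; rewrite /measurable /=; apply: sub_sigma_algebra. Qed.

Lemma closed_borel X (F : set X) : closed F -> measurable (F : set (borel X)).
Proof.
move=> cF; rewrite -[F]setCK; apply: (@measurableC _ (borel X)).
by apply: open_borel; rewrite openC.
Qed.

Lemma continuous_borel X Y (f : X -> Y) :
  continuous f -> measurable_fun setT (f : borel X -> borel Y).
Proof.
move=> cf; apply: (@measurability _ _ (borel X) (borel Y) _ _ open) => //.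
move=> _ [U oU <-]; rewrite setTI; apply: open_borel.
exact: open_comp.
Qed.

Lemma continuous_borel_real X (f : X -> R) :
  continuous f -> measurable_fun setT (f : borel X -> R).
Proof.
move=> cf; apply: (measurability _ (RGenOpens.measurableE R)).
move=> _ [_ [a [b ->]] <-]; rewrite setTI; apply: open_borel.
by apply: open_comp => //; exact: interval_open.
Qed.

Lemma closed_measure_support X (mu : probability (borel X) R) :
  closed (measure_support mu).
Proof.
rewrite -[measure_support mu]setCK; apply: open_closedC.
rewrite openE => x /existsNP[U /not_implyP[Ux /negP mU]].
apply: filterS (open_nbhs_nbhs Ux) => y Uy /(_ U) /= => h.
apply/negP: mU; rewrite negbK; apply: h.
by split => //; case: Ux.
Qed.

Lemma measurable_support X (mu : probability (borel X) R) :
  measurable (measure_support mu : set (borel X)).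
Proof. apply: closed_borel; exact: closed_measure_support. Qed.


Lemma closure_rangeP X (x : nat -> X) (y : X) :
  closure (range x) y <-> forall e : R, (0 < e)%R -> exists i, (`|y - x i| < e)%R.
Proof.
split=> [xy e e0|xy B /nbhs_ballP[e /= e0 eB]].
  have [_ [[i _ <-]]] := xy _ (nbhsx_ballx y e e0).
  by rewrite -ball_normE => ?; exists i.
have [i yi] := xy _ e0; exists (x i); split; first by exists i.
by apply: eB; rewrite -ball_normE.
Qed.

Lemma measurable_closure_range X (x : nat -> X) :
  measurable (closure (range x) : set (borel X)).
Proof. by apply: closed_borel; exact: closed_closure. Qed.

(** A point of the closure outside the support lies in a null ball centred at some [x i] with radius
    [j.+1%:R^-1]. There are countably many such balls, so the complement of the support is null. *)
Lemma full_support_separable X (mu : probability (borel X) R) (x : nat -> X) :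
  mu (closure (range x)) = 1 -> full_support mu.
Proof.
move=> mux; apply: probability_negligibleC; first exact: measurable_support.
pose F i j : set (borel X) := let B := ball (x i) (j.+1%:R^-1)%R in
  if mu B == 0 then B else set0.
have mB i j : measurable (ball (x i) j.+1%:R^-1 : set (borel X)).
  by apply: open_borel; exact: ball_open.
have : mu.-negligible (~` (closure (range x) : set (borel X)) `|`
    \bigcup_i \bigcup_j F i j).
  apply: negligibleU; first exact: negligible_setC1 (measurable_closure_range _) mux.
  apply: negligible_bigcup => i; apply: negligible_bigcup => j.
  rewrite /F; case: eqP => [B0|_]; last exact: negligible_set0.
  by exists (ball (x i : X) (j.+1%:R^-1)%R); split => //; exact: mB.
apply: negligibleS => y /existsNP[U /not_implyP[[oU Uy] /negP]].
rewrite lt_neqAle measure_ge0 andbT negbK => /eqP U0.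
have [/closure_rangeP xy|] := pselect (closure (range x) y); last by left.
right.
have /nbhs_ballP[e /= e0 eU] : nbhs y U by apply: open_nbhs_nbhs.
(* A radius below [e / 2] keeps a ball centred at [x i] and containing [y] inside the [e]-ball
   around [y], hence inside the null set [U]. *)
have [j] := @ltr_add_invr R 0 (e / 2)%R (divr_gt0 e0 (ltr0Sn _ 1)).
rewrite add0r => je.
have [i xi] := xy j.+1%:R^-1%R ltac:(by rewrite invr_gt0).
exists i => //; exists j => //.
have -> : F i j = ball (x i) (j.+1%:R^-1)%R.
  rewrite /F ifT// -measure_le0 [leRHS]U0 le_measure ?inE//; first exact: open_borel.
  apply: subset_trans eU => z; rewrite -!ball_normE /= => xz.
  rewrite (splitr e) (le_lt_trans (ler_distD (x i) _ _))// ltrD//.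
    exact: lt_trans je.
  exact: lt_trans je.
by rewrite -ball_normE /= distrC.
Qed.

(* A union of countably many [e]-balls of nearly maximal measure, and then of
   maximal measure, meets every [e]-ball around a point of the support. *)
Lemma support_net X (mu : probability (borel X) R) (e : R) : (0 < e)%R ->
  exists c : nat -> X, forall y, measure_support mu y ->
    exists i, (`|y - c i| < e + e)%R.
Proof.
move=> e0.
pose W (c : nat -> X) : set (borel X) := \bigcup_i ball (c i) e.
have mball y : measurable (ball y e : set (borel X)).
  by apply: open_borel; exact: ball_open.
have mW c : measurable (W c) by apply: bigcupT_measurable => i.
pose a := ereal_sup [set mu (W c) | c in setT].
have a1 : a <= 1 by apply: ge_ereal_sup => _ [c _ <-]; exact: probability_le1.
have a0 : 0 <= a by apply: (@le_trans _ _ (mu (W (fun=> point)))) => //;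
  apply: ereal_sup_ubound; exists (fun=> point).
have afin : a \is a fin_num by rewrite ge0_fin_numE// (le_lt_trans a1)// ltry.
have /choice[c cP] n : exists c, a - (n.+1%:R^-1)%:E < mu (W c).
  have n0 : (0 < n.+1%:R^-1 :> R)%R by rewrite invr_gt0.
  have [_ [c _ <-] ?] := ub_ereal_sup_adherent n0 afin.
  by exists c.
(* Pickling merges the centres of all the [c n] into one sequence, whose union attains the supremum
   [a]. *)
pose C k := if unpickle k is Some (n, i) then c n i else point.
exists C => y yS; apply: contrapT => nyC.
have aC : a <= mu (W C).
  apply/lee_addgt0Pr => r r0.
  have [n] := @ltr_add_invr R 0 r r0; rewrite add0r => nr.
  rewrite -leeBlDr// (@le_trans _ _ (mu (W (c n))))//.
    rewrite (le_trans _ (ltW (cP n)))// leeB// lee_fin; exact: ltW.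
  apply: le_measure; rewrite ?inE// => z [i _ ciz].
  by exists (pickle (n, i)) => //; rewrite /C pickleK.
(* If [y] were far from all centres, adding [ball y e] would add disjoint positive mass and exceed
   [a]. *)
pose C' k := if k is k'.+1 then C k' else y.
have WC' : W C' = ball y e `|` W C.
  apply/seteqP; split=> [z [[|k] _ ?]|z [?|[k _ ?]]]; [by left|by right; exists k| |].
    by exists 0%N.
  by exists k.+1.
have : mu (W C') <= a by apply: ereal_sup_ubound; exists C'.
rewrite WC' measureU//; last first.
  apply/seteqP; split=> // z [yz [i _ iz]]; apply: nyC; exists i.
  move: yz iz; rewrite -!ball_normE /= => yz iz.
  by rewrite (le_lt_trans (ler_distD z _ _))// ltrD// distrC.
apply/negP; rewrite -ltNge (le_lt_trans aC)// -[ltLHS]add0e lteD2rE//.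
  by apply: yS; split; [exact: ball_open|exact: ballxx].
exact: fin_num_measure.
Qed.

(** The nets of the support at all scales [n.+1%:R^-1], merged into one sequence, are dense in the
    support. *)
Lemma support_separable X (mu : probability (borel X) R) : full_support mu ->
  exists x : nat -> X, mu (closure (range x)) = 1.
Proof.
move=> mu1.
have /choice[c cP] n := @support_net X mu (n.+1%:R^-1)%R ltac:(by rewrite invr_gt0).
pose x k := if unpickle k is Some (n, i) then c n i else point.
exists x; apply/eqP; rewrite eq_le probability_le1/=; last exact: measurable_closure_range.
rewrite -mu1 le_measure ?inE//; [exact: measurable_support|exact: measurable_closure_range|].
move=> y yS; apply/closure_rangeP => e e0.
have [n] := @ltr_add_invr R 0 (e / 2)%R (divr_gt0 e0 (ltr0Sn _ 1)); rewrite add0r => ne.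
have [i yi] := cP n y yS.
exists (pickle (n, i)); rewrite /x pickleK (lt_le_trans yi)//.
by rewrite [leRHS]splitr lerD// ltW.
Qed.

End borel_sets.

(** * Simple functions with overlapping sets, and their integrals *)

Section simple_functions.
Context (R : realType) (d : measure_display) (T : measurableType d)
  (E : normedModType R).
Implicit Types (s r : simple_function T E) (mu : probability T R).

(** The sets of [s] may overlap; the level sets of [active s] cut [T] into finitely many disjoint
    measurable pieces on which [sf_fun s] is constant. *)
Definition active s (t : T) : {set 'I_(sf_size s)} :=
  finset (fun i => t \in sf_set s i).

Definition atom_value s (J : {set 'I_(sf_size s)}) : E :=
  (\sum_(i in J) sf_vec s i)%R.

Lemma sf_funE s t : sf_fun s t = atom_value (active s t).
Proof.
rewrite /sf_fun /atom_value [RHS]big_mkcond /=; apply: eq_bigr => i _.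
by rewrite inE indicE; case: ifP => _; rewrite ?scale1r ?scale0r.
Qed.

Lemma measurable_active s J : measurable (active s @^-1` [set J]).
Proof.
rewrite (_ : _ @^-1` _ = \bigcap_(i in setT)
    (if i \in J then sf_set s i else ~` sf_set s i)).
  apply: fin_bigcap_measurable => // i _; case: ifP => _; first exact: sf_measurable.
  by apply: measurableC; exact: sf_measurable.
apply/seteqP; split=> [t /= <- i _|t tJ]; first rewrite inE.
  by case: ifPn; rewrite ?inE// notin_setE.
apply/setP => i; rewrite inE; have := tJ i Logic.I; case: ifPn => _.
  by move=> ?; rewrite mem_set.
by move=> ?; rewrite memNset.
Qed.

(** Measurability reduces to that of each [h J] on finitely many pieces. This covers sums with
    simple functions even for non-separable [E], where adding two measurable maps may lose
    measurability. *)
Lemma measurable_piecewise s d' (U : measurableType d')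
    (h : {set 'I_(sf_size s)} -> T -> U) :
  (forall J, measurable_fun setT (h J)) ->
  measurable_fun setT (fun t => h (active s t) t).
Proof.
move=> mh _ B mB; rewrite setTI.
rewrite (_ : _ @^-1` _ = \bigcup_(J in setT) (active s @^-1` [set J] `&` h J @^-1` B)).
  apply: fin_bigcup_measurable => // J _; apply: measurableI.
    exact: measurable_active.
  by rewrite -[_ @^-1` _]setTI; exact: mh.
apply/seteqP; split=> [t Bt|t [J _ [<-//]]].
by exists (active s t).
Qed.

Lemma ge0_integral_active mu s (G : {set 'I_(sf_size s)} -> R) :
  (forall J, 0 <= G J)%R ->
  \int[mu]_t (G (active s t))%:E =
  (\sum_J G J * fine (mu (active s @^-1` [set J])))%:E.
Proof.
move=> G0; transitivity (\sum_J (G J)%:E * mu (active s @^-1` [set J])); last first.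
  rewrite -sumEFin; apply: eq_bigr => J _; rewrite EFinM fineK//.
  by apply: fin_num_measure; exact: measurable_active.
transitivity (\int[mu]_t \sum_J (G J)%:E * (\1_(active s @^-1` [set J]) t)%:E).
  apply: eq_integral => t _; rewrite (bigD1 (active s t))//= indicE mem_set//= mule1.
  rewrite big1 ?adde0// => J Jt.
  by rewrite indicE memNset ?mule0//= => tJ; rewrite tJ eqxx in Jt.
rewrite ge0_integral_sum//.
- apply: eq_bigr => J _; rewrite ge0_integralZl ?lee_fin//.
  + by rewrite integral_indic// ?setIT//; exact: measurable_active.
  + by apply/measurable_EFinP; apply: measurable_indic; exact: measurable_active.
- move=> J; apply: measurable_funeM; apply/measurable_EFinP.
  by apply: measurable_indic; exact: measurable_active.
- by move=> J t _; rewrite mule_ge0// lee_fin.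
Qed.

(** The mass of [sf_set s i] is the total mass of the pieces whose index set contains [i].
    Exchanging the sums regroups the integral over disjoint pieces, where the triangle inequality
    gives the L1 bound. *)
Lemma sf_integralE mu s : sf_integral mu s =
  (\sum_J fine (mu (active s @^-1` [set J])) *: atom_value J)%R.
Proof.
transitivity (\sum_(i < sf_size s) (\sum_(J : {set 'I_(sf_size s)})
    (i \in J)%:R * fine (mu (active s @^-1` [set J]))) *: sf_vec s i)%R.
  apply: eq_bigr => i _; congr (_ *: _)%R.
  rewrite -[RHS]/(fine (_%:E)) -ge0_integral_active; last by move=> J; case: (i \in J).
  congr fine; rewrite -[in LHS](setIT (sf_set s i)) -integral_indic//; last first.
    exact: sf_measurable.
  by apply: eq_integral => t _; rewrite indicE inE.
under eq_bigr do rewrite scaler_suml.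
rewrite exchange_big /=; apply: eq_bigr => J _.
rewrite /atom_value scaler_sumr [RHS]big_mkcond /=; apply: eq_bigr => i _.
by case: (i \in J); rewrite ?mul1r// mul0r scale0r.
Qed.

Lemma norm_sf_integral mu s :
  `|sf_integral mu s|%:E <= \int[mu]_t `|sf_fun s t|%:E.
Proof.
under eq_integral do rewrite sf_funE.
rewrite (@ge0_integral_active mu s (fun J => `|atom_value J|%R))//.
rewrite lee_fin sf_integralE (le_trans (ler_norm_sum _ _ _))//.
apply: ler_sum => J _; rewrite normrZ mulrC ler_wpM2l//.
by rewrite ger0_norm// fine_ge0.
Qed.

Lemma measurable_norm_sub_sf s (f : T -> E) :
  (forall y, measurable_fun setT (fun t => `|f t - y|%R)) ->
  measurable_fun setT (fun t => `|f t - sf_fun s t|%R).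
Proof.
move=> mf; under eq_fun do rewrite sf_funE.
exact: (@measurable_piecewise s _ _ (fun J t => `|f t - atom_value J|%R)).
Qed.

Lemma measurable_sf_fun s : measurable_fun setT (sf_fun s : T -> borel E).
Proof.
rewrite (_ : sf_fun s = fun t => atom_value (active s t)); last first.
  by apply/funext => t; rewrite sf_funE.
by apply: (@measurable_piecewise s _ (borel E) (fun J t => atom_value J)) => J.
Qed.

Definition sf_add s r : simple_function T E.
refine (@SimpleFunction _ _ _ (sf_size s + sf_size r)
  (fun i => match fintype.split i with inl j => sf_set s j | inr j => sf_set r j end)
  (fun i => match fintype.split i with inl j => sf_vec s j | inr j => sf_vec r j end) _).
by move=> i; case: fintype.split => j; exact: sf_measurable.
Defined.

Definition sf_opp s : simple_function T E :=
  SimpleFunction (fun i => (- sf_vec s i)%R) (sf_measurable s).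

Definition sf_restrict s (B : set T) (mB : measurable B) : simple_function T E :=
  @SimpleFunction _ _ _ (sf_size s) (fun i => sf_set s i `&` B) (sf_vec s)
  (fun i => measurableI _ _ (sf_measurable s i) mB).

Definition sf_cst (v : E) : simple_function T E :=
  @SimpleFunction _ _ _ 1 (fun=> setT) (fun=> v) (fun=> measurableT).

Lemma sf_fun_add s r t : sf_fun (sf_add s r) t = (sf_fun s t + sf_fun r t)%R.
Proof.
rewrite /sf_fun /= big_split_ord /=; congr (_ + _)%R; apply: eq_bigr => i _.
  by rewrite (unsplitK (inl i)).
by rewrite (unsplitK (inr i)).
Qed.

Lemma sf_integral_add mu s r :
  sf_integral mu (sf_add s r) = (sf_integral mu s + sf_integral mu r)%R.
Proof.
rewrite /sf_integral /= big_split_ord /=; congr (_ + _)%R; apply: eq_bigr => i _.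
  by rewrite (unsplitK (inl i)).
by rewrite (unsplitK (inr i)).
Qed.

Lemma sf_fun_opp s t : sf_fun (sf_opp s) t = (- sf_fun s t)%R.
Proof. by rewrite /sf_fun -sumrN; apply: eq_bigr => i _; rewrite scalerN. Qed.

Lemma sf_integral_opp mu s : sf_integral mu (sf_opp s) = (- sf_integral mu s)%R.
Proof. by rewrite /sf_integral -sumrN; apply: eq_bigr => i _; rewrite scalerN. Qed.

Lemma sf_fun_restrict s (B : set T) (mB : measurable B) t :
  sf_fun (sf_restrict s mB) t = (if t \in B then sf_fun s t else 0)%R.
Proof.
rewrite /sf_fun; case: ifPn => tB.
  by apply: eq_bigr => i _; rewrite !indicE in_setI tB andbT.
by apply: big1 => i _; rewrite indicE in_setI (negbTE tB) andbF scale0r.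
Qed.

Lemma sf_fun_cst v t : sf_fun (sf_cst v) t = v.
Proof. by rewrite /sf_fun /= big_ord1 indicT scale1r. Qed.

Definition sf_paste s (B : set T) (mB : measurable B) (v : E) :=
  sf_add (sf_restrict (sf_cst v) mB) (sf_restrict s (measurableC mB)).

Lemma sf_fun_paste s (B : set T) (mB : measurable B) v t :
  sf_fun (sf_paste s mB v) t = if t \in B then v else sf_fun s t.
Proof.
rewrite sf_fun_add !sf_fun_restrict in_setC sf_fun_cst.
by case: ifP => _ /=; rewrite ?addr0 ?add0r.
Qed.

(* Stated for two functions [f] and [g] since [f - g] need not be measurable
   when [E] is not separable. *)
Lemma dist_sf_integral mu s r (f g : T -> E) :
  (forall y, measurable_fun setT (fun t => `|f t - y|%R)) ->
  (forall y, measurable_fun setT (fun t => `|g t - y|%R)) ->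
  measurable_fun setT (fun t => `|f t - g t|%R) ->
  `|sf_integral mu s - sf_integral mu r|%:E <=
    \int[mu]_t `|f t - sf_fun s t|%:E + \int[mu]_t `|f t - g t|%:E +
    \int[mu]_t `|g t - sf_fun r t|%:E.
Proof.
move=> mf mg mfg.
have mfs := measurable_norm_sub_sf s mf; have mgr := measurable_norm_sub_sf r mg.
rewrite -sf_integral_opp -sf_integral_add (le_trans (norm_sf_integral _ _))//.
rewrite -ge0_integralD//; [|exact/measurable_EFinP..].
rewrite -ge0_integralD//; last 3 first.
- by move=> t _; rewrite -EFinD lee_fin addr_ge0.
- by apply: emeasurable_funD; exact/measurable_EFinP.
- exact/measurable_EFinP.
- apply: ge0_le_integral => //.
  + apply/measurable_EFinP.
    (* A norm is a distance to the zero function, so [measurable_norm_sub_sf] applies. *)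
    under eq_fun do rewrite -[X in `|X|%R]opprK normrN -sub0r.
    by apply: measurable_norm_sub_sf => y.
  + by apply: emeasurable_funD; [apply: emeasurable_funD|]; exact/measurable_EFinP.
  + move=> t _; rewrite sf_fun_add sf_fun_opp -!EFinD lee_fin.
    rewrite (le_trans (ler_distD (g t) _ _))// lerD2r.
    by rewrite (le_trans (ler_distD (f t) _ _))// lerD2r distrC.
Qed.

End simple_functions.

(** * Change of variables along a measure-preserving map *)

Section pushforward.
Context (R : realType) d d' (T : measurableType d) (T' : measurableType d').
Variables (mu : probability T R) (nu : probability T' R) (phi : T -> T').
Hypothesis mphi : measurable_fun setT phi.
Hypothesis nuE : forall B, measurable B -> mu (phi @^-1` B) = nu B.

(** The image measure is known only through [nuE], so that distributions and marginals of couplings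
    are treated alike. *)
Lemma ge0_integral_image (g : T' -> \bar R) :
  measurable_fun setT g -> (forall y, 0 <= g y) ->
  \int[nu]_y g y = \int[mu]_x g (phi x).
Proof.
move=> mg g0; rewrite -[RHS]/(\int[mu]_(x in phi @^-1` setT) (g \o phi) x).
rewrite -(ge0_integral_pushforward mphi)//.
by apply: eq_measure_integral => B mB _; exact/esym/nuE.
Qed.

Lemma preimage_negligible (B : set T') :
  nu.-negligible B -> mu.-negligible (phi @^-1` B).
Proof.
move=> [N [mN N0 BN]]; exists (phi @^-1` N); split.
- by rewrite -[_ @^-1` _]setTI; exact: mphi.
- by rewrite -N0; exact: nuE.
- by move=> t /BN.
Qed.

Variable E : normedModType R.

Definition sf_comp (s : simple_function T' E) : simple_function T E.
refine (@SimpleFunction _ _ _ (sf_size s) (fun i => phi @^-1` sf_set s i) (sf_vec s) _).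
by move=> i; rewrite -[_ @^-1` _]setTI; apply: mphi => //; exact: sf_measurable.
Defined.

Lemma sf_integral_comp s : sf_integral mu (sf_comp s) = sf_integral nu s.
Proof. by apply: eq_bigr => i _; rewrite /= nuE//; exact: sf_measurable. Qed.

Lemma measurable_dist (f : T' -> E) : measurable_fun setT (f : T' -> borel E) ->
  forall y, measurable_fun setT (fun t => `|f t - y|%R).
Proof.
move=> mf y; apply: (@measurableT_comp _ _ _ _ (borel E) _
  (fun x : borel E => `|(x : E) - y|%R)) => //.
apply: continuous_borel_real => x; apply: cvg_norm.
by apply: cvgB => //; exact: cvg_cst.
Qed.

Lemma bochner_approximation_comp (f : T' -> E) (s : nat -> simple_function T' E) :
  measurable_fun setT (f : T' -> borel E) ->
  bochner_approximation nu f s ->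
  bochner_approximation mu (f \o phi) (fun n => sf_comp (s n)).
Proof.
move=> mf [sf intsf]; split; first exact: preimage_negligible sf.
rewrite (_ : (fun n => _) = fun n => \int[nu]_t `|f t - sf_fun (s n) t|%:E)//.
apply/funext => n; rewrite ge0_integral_image//.
apply/measurable_EFinP; apply: measurable_norm_sub_sf; exact: measurable_dist.
Qed.

End pushforward.

(** * The Bochner integral as a limit of integrals of simple functions *)

Section bochner_integral.
Context (R : realType).

Lemma cvge0_near_lt (u : (\bar R)^nat) (e : R) :
  u @ \oo --> 0 -> (0 < e)%R -> \forall n \near \oo, u n < e%:E.
Proof.
move=> u0 e0; apply: (u0 [set x | x < e%:E]).
by apply: open_nbhs_nbhs; split; [exact: open_ereal_lt_ereal|rewrite /= lte_fin].
Qed.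

Context d (T : measurableType d) (mu : probability T R).

(** The case [f = g] of [dist_sf_integral]; it yields both the Cauchy property and the independence
    of the approximating sequence. *)
Lemma dist_approximations (E : normedModType R) (f : T -> E) s r :
  measurable_fun setT (f : T -> borel E) ->
  `|sf_integral mu s - sf_integral mu r|%:E <=
    \int[mu]_t `|f t - sf_fun s t|%:E + \int[mu]_t `|f t - sf_fun r t|%:E.
Proof.
move=> /measurable_dist mf.
have := @dist_sf_integral _ _ _ _ mu s r f f mf mf.
under [X in measurable_fun _ X]eq_fun do rewrite subrr normr0.
under [X in _ + X + _]eq_integral do rewrite subrr normr0.
by rewrite integral0 adde0; apply; exact: measurable_cst.
Qed.

Context (E : completeNormedModType R).
Implicit Types (f : T -> E) (s : nat -> simple_function T E).

Lemma is_cvg_sf_integral f s : measurable_fun setT (f : T -> borel E) ->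
  bochner_approximation mu f s -> cvgn (fun n => sf_integral mu (s n)).
Proof.
move=> mf [_ sf]; apply/cauchy_cvgP/cauchy_ballP => e e0.
pose A := [set n | \int[mu]_t `|f t - sf_fun (s n) t|%:E < (e / 2)%:E].
have sA : \forall n \near \oo, A n by apply: cvge0_near_lt => //; rewrite divr_gt0.
pose Q := [set sf_integral mu (s n) | n in A].
have sQ : \forall n \near \oo, Q (sf_integral mu (s n)).
  by apply: filterS sA => n An; exists n.
exists (Q, Q) => //= -[_ _] [/= [n An <-] [m Am <-]].
rewrite -ball_normE /= -lte_fin; apply: le_lt_trans (dist_approximations _ _ mf) _.
by rewrite (splitr e) EFinD lteD.
Qed.

Lemma bochner_integral_cvg f s : measurable_fun setT (f : T -> borel E) ->
  bochner_approximation mu f s ->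
  sf_integral mu (s n) @[n --> \oo] --> bochner_integral mu f.
Proof.
move=> mf sf; rewrite /bochner_integral.
set P := (X in xget _ X).
(* Completeness makes the set of limits nonempty; [r] is an approximating sequence behind the
   selected value. *)
have [r rf rv] : P (xget 0%R P).
  have /cvg_ex[v sv] := is_cvg_sf_integral mf sf.
  by apply: xgetPex; exists v; exists s.
apply/cvgrPdist_lt => e e0; near=> n.
rewrite (splitr e) (le_lt_trans (ler_distD (sf_integral mu (r n)) _ _))// ltrD//.
  by near: n; move/cvgrPdist_lt : rv; apply; rewrite divr_gt0.
rewrite -lte_fin; apply: le_lt_trans (dist_approximations _ _ mf) _.
rewrite (splitr (e / 2)) EFinD lteD//; near: n.
  by apply: cvge0_near_lt; [exact: rf.2|rewrite !divr_gt0].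
by apply: cvge0_near_lt; [exact: sf.2|rewrite !divr_gt0].
Unshelve. all: by end_near. Qed.

End bochner_integral.

(** Pulling simple functions back along [phi] preserves their integrals and their L1 distances to
    the integrand. This serves both for the given map and for the projections of a coupling. *)
Lemma bochner_integral_comp (R : realType) d d' (T : measurableType d)
    (T' : measurableType d') (mu : probability T R) (nu : probability T' R)
    (phi : T -> T') (E : completeNormedModType R) (f : T' -> E) :
  measurable_fun setT phi ->
  (forall B, measurable B -> mu (phi @^-1` B) = nu B) ->
  measurable_fun setT (f : T' -> borel E) -> bochner_integrable nu f ->
  bochner_integrable mu (f \o phi) /\
  bochner_integral mu (f \o phi) = bochner_integral nu f.
Proof.
move=> mphi nuE mf [s sf].
have sfphi := bochner_approximation_comp mphi nuE mf sf.
split; first by exists (fun n => sf_comp mphi (s n)).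
have mfphi : measurable_fun setT (f \o phi : T -> borel E).
  exact: (measurableT_comp mf mphi).
apply: (cvg_unique _ (bochner_integral_cvg mfphi sfphi)) => //=.
rewrite (_ : (fun n => _) = fun n => sf_integral nu (s n)).
  exact: bochner_integral_cvg.
by apply/funext => n; exact: sf_integral_comp.
Qed.

(** * Bochner integrability and membership in [P1] *)

Section integrable_P1.
Context (R : realType).

Lemma P1_integrable_id (E : normedModType R) (nu : probability (borel E) R) :
  P1 nu -> bochner_integrable nu (id : borel E -> E).
Proof.
move=> [/support_separable[x nux] [y inty]].
have mdist z : measurable_fun setT (fun t : borel E => `|(t : E) - z|%R).
  exact: measurable_dist.
(* The value is moved to [x n] wherever that point is strictly closer. Starting from the constant
   [y] keeps the error below the integrable function [|t - y|], as dominated convergence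
   requires. *)
have greedy n : exists s : simple_function (borel E) E, forall t : E,
    (`|t - sf_fun s t| <= `|t - y|)%R /\
    forall j, (j < n)%N -> (`|t - sf_fun s t| <= `|t - x j|)%R.
  elim: n => [|n [s sP]].
    by exists (sf_cst _ y) => t; rewrite sf_fun_cst.
  have mB : measurable ([set t : borel E | `|(t : E) - x n| < `|(t : E) - sf_fun s t|]%R).
    rewrite -[X in measurable X]setTI.
    apply: measurable_fun_ltr => //; exact: (@measurable_norm_sub_sf _ _ _ _ s id).
  exists (sf_paste s mB (x n)) => t; rewrite sf_fun_paste.
  have [sy sx] := sP t; case: ifPn.
    rewrite inE /= => /ltW xs; split; first exact: le_trans sy.
    move=> j; rewrite ltnS leq_eqVlt => /predU1P[->//|/sx]; exact: le_trans.
  rewrite notin_setE /= => /negP; rewrite -leNgt => sx'; split => // j.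
  by rewrite ltnS leq_eqVlt => /predU1P[->//|/sx].
have [s sP] := choice greedy.
have cvgs (t : E) : closure (range x) t -> sf_fun (s n) t @[n --> \oo] --> t.
  move=> /closure_rangeP xt; apply/cvgrPdist_lt => e e0.
  have [i ti] := xt e e0; exists i.+1 => // n /= ni.
  exact: le_lt_trans ((sP n t).2 _ ni) ti.
have cvgae : {ae nu, forall t : borel E, sf_fun (s n) t @[n --> \oo] --> (t : E)}.
  apply: negligibleS (negligible_setC1 (measurable_closure_range _) nux).
  by move=> t /=; apply: contra_not; exact: cvgs.
exists s; split => //.
have [| | | | |_ _] := @dominated_convergence _ (borel E) R nu setT measurableT
  (fun n t => `|(t : E) - sf_fun (s n) t|%:E) (cst 0) (fun t => `|(t : E) - y|%:E).
- by move=> n; apply/measurable_EFinP; exact: (@measurable_norm_sub_sf _ _ _ _ (s n) id).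
- exact: measurable_cst.
- apply: filterS cvgae => t st _; apply: cvg_EFin; first exact: nearW.
  apply/cvgrPdist_lt => e e0; move/cvgrPdist_lt : st => /(_ e e0).
  by apply: filterS => n; rewrite sub0r normrN /= normr_id.
- apply/integrableP; split; first exact/measurable_EFinP.
  by under eq_integral do rewrite abse_EFin normr_id.
- by apply: aeW => t n _; rewrite lee_fin normr_id; exact: (sP n t).1.
- by rewrite integral0.
Qed.

Lemma bochner_integrable_P1 d (T : measurableType d) (mu : probability T R)
    (E : normedModType R) (nu : probability (borel E) R) (f : T -> E) :
  measurable_fun setT (f : T -> borel E) ->
  (forall B : set (borel E), measurable B -> mu (f @^-1` B) = nu B) ->
  bochner_integrable mu f -> P1 nu.
Proof.
move=> mf nuE [s [sf intsf]]; split.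
  (* The sequence [x] lists all possible values of all the [s n], one for each set [J] of active
     indices. *)
  pose x k := if unpickle k is Some (existT n J) then
    @atom_value _ _ _ _ (s n) J else 0%R.
  apply: (@full_support_separable _ _ _ x).
  rewrite -nuE; last exact: measurable_closure_range.
  apply: probability_negligibleC.
    by rewrite -[_ @^-1` _]setTI; apply: mf => //; exact: measurable_closure_range.
  apply: negligibleS sf => t; apply: contra_not => st.
  apply/closure_rangeP => e e0; move/cvgrPdist_lt : st => /(_ e e0)[n _ /(_ n (leqnn n))].
  rewrite sf_funE => ?.
  exists (pickle (existT (fun n => {set 'I_(sf_size (s n))}) n (active (s n) t))).
  by rewrite /x pickleK.
exists 0%R; rewrite (ge0_integral_image mf nuE)//; last first.
  by apply/measurable_EFinP; exact: (@measurable_dist _ _ (borel E) E id).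
(* One approximant at L1 distance below [1] suffices, since a simple function has integrable
   norm. *)
have [n _ /(_ n (leqnn n)) /= intn] := cvge0_near_lt intsf (@ltr01 R).
apply: (@le_lt_trans _ _ (\int[mu]_t `|f t - sf_fun (s n) t|%:E +
    \int[mu]_t `|sf_fun (s n) t|%:E)); last first.
  rewrite lte_add_pinfty//; first by rewrite (lt_trans intn)// ltry.
  under eq_integral do rewrite sf_funE.
  by rewrite (@ge0_integral_active _ _ _ _ mu (s n) (fun J => `|atom_value J|%R))// ltry.
have mfs : measurable_fun setT (fun t => `|f t - sf_fun (s n) t|%R).
  by apply: measurable_norm_sub_sf; exact: measurable_dist.
have ms : measurable_fun setT (fun t => `|sf_fun (s n) t|%R).
  under eq_fun do rewrite -normrN -sub0r.
  by apply: measurable_norm_sub_sf => y.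
rewrite -ge0_integralD//; [|exact/measurable_EFinP..].
apply: ge0_le_integral => //.
- by apply/measurable_EFinP; exact: measurable_dist.
- by apply: emeasurable_funD; exact/measurable_EFinP.
- move=> t _; rewrite subr0 -EFinD lee_fin.
  by rewrite -{1}(subrK (sf_fun (s n) t) (f t)) ler_normD.
Qed.

End integrable_P1.

(** * Couplings on the product space *)

Section couplings.
Context (R : realType) (E : normedModType R).
Implicit Types (mu nu : probability (borel E) R)
  (p : probability (borel (E * E)%type) R).

Lemma measurable_fst_borel :
  measurable_fun setT (fst : borel (E * E)%type -> borel E).
Proof. by apply: (@continuous_borel _ (E * E)%type E fst) => z; exact: cvg_fst. Qed.

Lemma measurable_snd_borel :
  measurable_fun setT (snd : borel (E * E)%type -> borel E).
Proof. by apply: (@continuous_borel _ (E * E)%type E snd) => z; exact: cvg_snd. Qed.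

Lemma measurable_dist_borel : measurable_fun setT
  (fun z : borel (E * E)%type => `|(z : E * E).1 - (z : E * E).2|%R).
Proof.
apply: (@continuous_borel_real _ (E * E)%type
  (fun z : E * E => `|z.1 - z.2|%R)) => z.
by apply: cvg_norm; apply: cvgB; [exact: cvg_fst|exact: cvg_snd].
Qed.

(* Separability of the marginals makes the product support condition automatic. *)
Lemma full_support_coupling p mu nu : full_support mu -> full_support nu ->
  (forall B : set (borel E), measurable B -> p (fst @^-1` B) = mu B) ->
  (forall B : set (borel E), measurable B -> p (snd @^-1` B) = nu B) ->
  full_support p.
Proof.
move=> /support_separable[x mux] /support_separable[y nuy] p1 p2.
pose z k := if unpickle k is Some (i, j) then (x i, y j) else (x 0%N, y 0%N).
apply: (@full_support_separable _ (E * E)%type _ z).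
apply: probability_negligibleC; first exact: (@measurable_closure_range _ (E * E)%type).
have nx := preimage_negligible measurable_fst_borel p1
  (negligible_setC1 (measurable_closure_range _) mux).
have ny := preimage_negligible measurable_snd_borel p2
  (negligible_setC1 (measurable_closure_range _) nuy).
apply: negligibleS (negligibleU nx ny) => -[a b]; apply: contra_notP.
move=> /not_orP[/= /contrapT /closure_rangeP xa /contrapT /closure_rangeP yb].
apply/(@closure_rangeP _ (E * E)%type) => e e0.
have [i xi] := xa e e0; have [j yj] := yb e e0.
(* The product norm is the maximum norm, so the coordinates can be approximated separately. *)
by exists (pickle (i, j)); rewrite /z pickleK prod_normE /= gt_max xi yj.
Qed.

End couplings.

(** * Contractivity of the Bochner integral for the Wasserstein distance *)

Section contraction.
Context (R : realType) (E : completeNormedModType R).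
Implicit Types (mu nu : probability (borel E) R).

Lemma dist_bochner_integral d (T : measurableType d) (p : probability T R)
    (f g : T -> E) :
  measurable_fun setT (f : T -> borel E) -> measurable_fun setT (g : T -> borel E) ->
  measurable_fun setT (fun t => `|f t - g t|%R) ->
  bochner_integrable p f -> bochner_integrable p g ->
  `|bochner_integral p f - bochner_integral p g|%:E <= \int[p]_t `|f t - g t|%:E.
Proof.
move=> mf mg mfg [s sf] [r rg]; apply/lee_addgt0Pr => e e0.
have sI := bochner_integral_cvg mf sf; have rI := bochner_integral_cvg mg rg.
(* The budget [e] is split into four: two L1 errors and two errors of the integrals. *)
have e4 : (0 < e / 2 / 2)%R by rewrite !divr_gt0.
have [n _ /(_ n (leqnn n)) [[/= sn rn] [sIn rIn]]] :
    \forall n \near \oo, (\int[p]_t `|f t - sf_fun (s n) t|%:E < (e / 2 / 2)%:E /\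
     \int[p]_t `|g t - sf_fun (r n) t|%:E < (e / 2 / 2)%:E) /\
    (`|bochner_integral p f - sf_integral p (s n)| < e / 2 / 2 /\
     `|bochner_integral p g - sf_integral p (r n)| < e / 2 / 2)%R.
  apply: filterI; apply: filterI.
  - by apply: cvge0_near_lt => //; exact: sf.2.
  - by apply: cvge0_near_lt => //; exact: rg.2.
  - by move/cvgrPdist_lt : sI; exact.
  - by move/cvgrPdist_lt : rI; exact.
have := @dist_sf_integral _ _ _ _ p (s n) (r n) f g (measurable_dist mf)
  (measurable_dist mg) mfg.
set I := \int[p]_t `|f t - g t|%:E => sr.
apply: (@le_trans _ _ ((e / 2 / 2 + e / 2 / 2)%:E +
    `|sf_integral p (s n) - sf_integral p (r n)|%:E)).
  rewrite -EFinD lee_fin; rewrite distrC in rIn.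
  have := ler_distD (sf_integral p (s n)) (bochner_integral p f) (bochner_integral p g).
  have := ler_distD (sf_integral p (r n)) (sf_integral p (s n)) (bochner_integral p g).
  lra.
apply: (@le_trans _ _ ((e / 2 / 2 + e / 2 / 2)%:E +
    ((e / 2 / 2)%:E + I + (e / 2 / 2)%:E))).
  rewrite leeD2l// (le_trans sr)// leeD//; last exact: ltW.
  by rewrite leeD2r// ltW.
have : 0 <= I by apply: integral_ge0 => t _; rewrite lee_fin.
case: (I) => [i _| |//]; last by rewrite addye ?leey.
by rewrite -!EFinD lee_fin; lra.
Qed.

(** For any coupling [p], the two integrals are those of [fst] and [snd] against [p], so they differ
    by at most the transport cost of [p]. *)
Lemma bochner_integral_contractive mu nu : P1 mu -> P1 nu ->
  `|bochner_integral mu (id : borel E -> E) -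
    bochner_integral nu (id : borel E -> E)|%:E <= wasserstein mu nu.
Proof.
move=> /P1_integrable_id imu /P1_integrable_id inu.
apply: le_ereal_inf_tmp => _ [p [_ p1 p2] <-].
have mid := @measurable_id _ (borel E) setT.
have [if1 <-] := bochner_integral_comp (@measurable_fst_borel R E) p1 mid imu.
have [if2 <-] := bochner_integral_comp (@measurable_snd_borel R E) p2 mid inu.
apply: dist_bochner_integral => //.
- exact: measurable_fst_borel.
- exact: measurable_snd_borel.
- exact: measurable_dist_borel.
Qed.

End contraction.

(** * Finitely supported measures and existence of the barycentric map *)

Section discrete.
Context (R : realType).

(* Only the first [m] terms of [p] and [y] matter. *)
Definition discrete d (T : measurableType d) (m : nat) (p : nat -> R) (y : nat -> T)
    (nu : probability T R) :=
  (forall k, 0 <= p k)%R /\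
  (forall B, measurable B -> nu B = (\sum_(k < m) p k * \1_B (y k))%R%:E).

Definition dirac_sum d (T : measurableType d) (p : nat -> R) (p0 : forall k, (0 <= p k)%R)
    (y : nat -> T) (m : nat) : {measure set T -> \bar R} :=
  msum (fun k => mscale (NngNum (p0 k)) (\d_(y k))) m.

Lemma dirac_sumE d (T : measurableType d) p p0 (y : nat -> T) m B :
  @dirac_sum d T p p0 y m B = (\sum_(k < m) p k * \1_B (y k))%R%:E.
Proof.
rewrite /dirac_sum /msum -sumEFin; apply: eq_bigr => k _.
by rewrite /mscale /= /dirac /= EFinM.
Qed.

Lemma discrete_sum1 d (T : measurableType d) m p (y : nat -> T) nu :
  discrete m p y nu -> (\sum_(k < m) p k = 1)%R.
Proof.
move=> [_ /(_ setT measurableT)]; rewrite probability_setT => -[->].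
by apply: eq_bigr => k _; rewrite indicT mulr1.
Qed.

Lemma discrete_ex d (T : measurableType d) m (p : nat -> R) (y : nat -> T) :
  (forall k, 0 <= p k)%R -> (\sum_(k < m) p k = 1)%R ->
  exists nu, discrete m p y nu.
Proof.
move=> p0 p1; exists (mnormalize (dirac_sum p0 y m) \d_(y 0%N)).
split=> // B mB; rewrite -(dirac_sumE p0) [LHS]/= /mnormalize.
have -> : dirac_sum p0 y m setT = 1.
  rewrite dirac_sumE; congr EFin; rewrite -p1.
  by apply: eq_bigr => k _; rewrite indicT mulr1.
by rewrite onee_eq0 /= invr1 mule1.
Qed.

Lemma discrete_integral d (T : measurableType d) m p (y : nat -> T) nu (g : T -> R) :
  discrete m p y nu -> measurable_fun setT g -> (forall t, 0 <= g t)%R ->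
  \int[nu]_t (g t)%:E = (\sum_(k < m) p k * g (y k))%R%:E.
Proof.
move=> [p0 nuE] mg g0.
transitivity (\int[dirac_sum p0 y m]_t (g t)%:E).
  by apply: eq_measure_integral => B mB _; rewrite dirac_sumE; exact: nuE.
have mg' : measurable_fun setT (EFin \o g) by exact/measurable_EFinP.
rewrite ge0_integral_measure_sum//; last by move=> t _; rewrite lee_fin.
rewrite -sumEFin; apply: eq_bigr => k _.
rewrite ge0_integral_mscale//; last by move=> t _; rewrite lee_fin.
by rewrite integral_dirac// diracT mul1e EFinM.
Qed.

Lemma discrete_P1 (E : normedModType R) m p y (nu : probability (borel E) R) :
  discrete m p y nu -> P1 nu.
Proof.
move=> nud; split; last first.
  exists 0%R; rewrite (discrete_integral nud) ?ltry//.
  exact: (@measurable_dist _ _ (borel E) E id).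
apply: (@full_support_separable _ _ _ y).
have [_ ->] := nud; last exact: measurable_closure_range.
rewrite -(discrete_sum1 nud); congr EFin; apply: eq_bigr => k _.
by rewrite indicE mem_set ?mulr1//; apply: subset_closure; exists k.
Qed.

(** Against [nu], a simple function has as integral the weighted sum of its values at the atoms, and
    as L1 error the weighted sum of its errors there. The latter tends to zero and bounds the
    distance to the claimed sum. *)
Lemma discrete_bochner_integral (E : completeNormedModType R) m p y
    (nu : probability (borel E) R) : discrete m p y nu ->
  bochner_integral nu (id : borel E -> E) = (\sum_(k < m) p k *: (y k : E))%R.
Proof.
move=> nud; have [s sid] := P1_integrable_id (discrete_P1 nud).
have mid := @measurable_id _ (borel E) setT.
apply: (cvg_unique _ (bochner_integral_cvg mid sid)) => //=.
have sE n : sf_integral nu (s n) = (\sum_(k < m) p k *: sf_fun (s n) (y k))%R.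
  rewrite /sf_integral /sf_fun.
  under [RHS]eq_bigr do rewrite scaler_sumr.
  rewrite exchange_big /=; apply: eq_bigr => i _.
  rewrite nud.2 /=; last exact: sf_measurable.
  by rewrite scaler_suml; apply: eq_bigr => k _; rewrite scalerA.
have [_ ints] := sid.
apply/cvgrPdist_lt => e e0; apply: filterS (cvge0_near_lt ints e0) => n.
rewrite (discrete_integral nud)//; last first.
  by apply: (@measurable_norm_sub_sf _ _ _ _ (s n) id); exact: measurable_dist.
rewrite lte_fin; apply: le_lt_trans; rewrite sE -sumrB (le_trans (ler_norm_sum _ _ _))//.
apply: ler_sum => k _; rewrite -scalerBr normrZ ger0_norm//; exact: nud.1.
Qed.

Lemma discrete_dirac d (T : measurableType d) (x : T) :
  discrete 1 (fun=> 1%R) (fun=> x) (\d_x : probability T R).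
Proof. by split=> [_|B mB]; rewrite ?ler01// big_ord1 mul1r. Qed.

Lemma discrete_uniform_atoms (E : normedModType R) n (x : nat -> E) :
  discrete n.+1 (fun=> n.+1%:R^-1)%R (x : nat -> borel E) (uniform_atoms R n x).
Proof.
split=> [_|B mB]; first by rewrite invr_ge0.
rewrite /uniform_atoms /mscale /msum /= -mulr_sumr EFinM; congr *%E.
by rewrite -sumEFin.
Qed.

Lemma bochner_integral_arithmetic (E : completeNormedModType R) :
  arithmetic_barycentric (fun nu : probability (borel E) R =>
    bochner_integral nu (id : borel E -> E)).
Proof.
split; first split.
- move=> x; rewrite (discrete_bochner_integral (discrete_dirac (x : borel E))).
  by rewrite big_ord1 scale1r.
- by move=> mu nu; exact: bochner_integral_contractive.
- move=> n x; rewrite (discrete_bochner_integral (discrete_uniform_atoms n x)).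
  by rewrite scaler_sumr.
Qed.

End discrete.

(** * Wasserstein density of uniform measures and uniqueness of the barycentric map *)

Section density.
Context (R : realType).

Lemma image_probability d d' (T : measurableType d) (T' : measurableType d')
    (P : probability T R) (phi : T -> T') : measurable_fun setT phi ->
  exists nu : probability T' R, forall B, nu B = P (phi @^-1` B).
Proof.
move=> mphi; pose phi_mfun := isMeasurableFun.Build _ _ _ _ _ mphi.
pose phi' : {mfun T >-> T'} := HB.pack phi phi_mfun.
by exists (distribution P phi').
Qed.

Context (E : normedModType R).
Implicit Types (mu nu : probability (borel E) R).

(** The image of [P] under the pair [(a, b)] is a coupling. The pair must be measurable for the
    Borel sets of the product topology, which may be more than measurability of [a] and [b]. *)
Lemma wasserstein_le d (T : measurableType d) (P : probability T R) mu nu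
    (a b : T -> E) :
  full_support mu -> full_support nu ->
  measurable_fun setT ((fun t => (a t, b t)) : T -> borel (E * E)%type) ->
  (forall B : set (borel E), measurable B -> P (a @^-1` B) = mu B) ->
  (forall B : set (borel E), measurable B -> P (b @^-1` B) = nu B) ->
  wasserstein mu nu <= \int[P]_t `|a t - b t|%:E.
Proof.
move=> smu snu mab Pa Pb; have [p pE] := image_probability P mab.
apply: ereal_inf_lbound; exists p; last first.
  rewrite (ge0_integral_image mab (fun B _ => esym (pE B)))//.
  by apply/measurable_EFinP; exact: measurable_dist_borel.
have p1 (B : set (borel E)) : measurable B -> p (fst @^-1` B) = mu B.
  by move=> mB; rewrite pE -Pa.
have p2 (B : set (borel E)) : measurable B -> p (snd @^-1` B) = nu B.
  by move=> mB; rewrite pE -Pb.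
by split => //; exact: full_support_coupling p1 p2.
Qed.

(** The discrete measure is the image of [mu] under a simple function; the graph of that function
    couples the two at the cost of the L1 error. *)
Lemma P1_near_discrete mu (e : R) : P1 mu -> (0 < e)%R ->
  exists m p y nu, discrete m p y nu /\ wasserstein mu nu <= e%:E.
Proof.
move=> P1mu e0; have [s [_ ints]] := P1_integrable_id P1mu.
have [n _ /(_ n (leqnn n)) /= intn] := cvge0_near_lt ints e0.
have [nu nuE] := image_probability mu (measurable_sf_fun (s n)).
pose N := index_enum {set 'I_(sf_size (s n))}.
pose p k := fine (mu (active (s n) @^-1` [set nth finset.set0 N k])).
pose y k := atom_value (nth finset.set0 N k) : borel E.
have nud : discrete (size N) p y nu.
  split=> [k|B mB]; first exact: fine_ge0.
  rewrite nuE -[LHS]/(mu (sf_fun (s n) @^-1` B)) -[_ @^-1` B in LHS]setIT.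
  have mB' : measurable (sf_fun (s n) @^-1` B).
    by rewrite -[_ @^-1` _]setTI; exact: measurable_sf_fun.
  rewrite -integral_indic//.
  transitivity (\int[mu]_t (\1_B (atom_value (active (s n) t) : borel E))%:E).
    by apply: eq_integral => t _; rewrite -sf_funE.
  rewrite (@ge0_integral_active _ _ _ _ mu (s n)
    (fun J => \1_B (atom_value J : borel E)))//.
  congr EFin; rewrite (big_nth finset.set0) big_mkord.
  by apply: eq_bigr => k _; rewrite mulrC.
exists (size N), p, y, nu; split => //.
apply: le_trans (ltW intn).
apply: (@wasserstein_le _ (borel E) mu mu nu id (sf_fun (s n))) => //.
- exact: P1mu.1.
- exact: (discrete_P1 nud).1.
- rewrite (_ : (fun t => _) = fun t : E => (t, atom_value (active (s n) t))); last first.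
    by apply/funext => t; rewrite sf_funE.
  (* On each piece the graph is [t |-> (t, v)] with [v] fixed, hence continuous. *)
  apply: (@measurable_piecewise _ _ (borel E) _ (s n) _
    (borel (E * E)%type) (fun J t => (t : E, atom_value J))) => J.
  apply: (@continuous_borel _ E (E * E)%type) => t.
  by apply: cvg_pair => //=; exact: cvg_cst.
Qed.

Lemma sum_seq_atoms (m : nat) (c : nat -> nat) (y : nat -> E) (l : nat) (h : E -> R) :
  (\sum_(v <- flatten [seq nseq (c k) (y k) | k <- iota 0 m] ++ nseq l 0%R) h v =
   \sum_(k < m) (c k)%:R * h (y k) + l%:R * h 0)%R.
Proof.
rewrite big_cat big_flatten /= big_map big_nseq iter_addr_0 mulr_natl.
rewrite -[m in iota _ m]subn0 big_mkord; congr (_ + _)%R.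
by apply: eq_bigr => k _; rewrite big_nseq iter_addr_0 mulr_natl.
Qed.

(* With [n.+1] atoms, the atom [y k] is repeated [floor (n.+1 * p k)] times and
   the remaining atoms are put at [0]; the excess mass of [nu] at [y k], at most
   [1 / n.+1], is transported to [0]. *)
Lemma discrete_near_uniform m p (y : nat -> borel E) nu (n : nat) :
  discrete m p y nu ->
  exists x, wasserstein nu (uniform_atoms R n x) <=
    (n.+1%:R^-1 * \sum_(k < m) `|y k : E|)%R%:E.
Proof.
move=> nud; have [p0 nuE] := nud; have p1 := discrete_sum1 nud.
have N0 : (0 < n.+1%:R :> R)%R by rewrite ltr0n.
pose c k := Num.truncn (n.+1%:R * p k)%R.
pose q k := ((c k)%:R / n.+1%:R : R)%R.
have q0 k : (0 <= q k)%R by rewrite divr_ge0.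
have qp k : (q k <= p k)%R.
  by rewrite ler_pdivrMr// mulrC truncn_le mulr_ge0// ltW.
have pq k : (p k - q k <= n.+1%:R^-1)%R.
  rewrite lerBlDl -[X in (_ + X)%R]div1r -mulrDl ler_pdivlMr// mulrC natr1.
  exact/ltW/truncnS_gt.
(* The floors sum to at most [n.+1], so the truncated subtraction defining [l] is exact. *)
have cN : (\sum_(k < m) c k <= n.+1)%N.
  rewrite -(ler_nat R) natr_sum -[leRHS]mulr1 -[X in (_ * X)%R]p1 mulr_sumr.
  by apply: ler_sum => k _; rewrite truncn_le mulr_ge0// ltW.
pose l := (n.+1 - \sum_(k < m) c k)%N.
pose L := flatten [seq nseq (c k) (y k : E) | k <- iota 0 m] ++ nseq l 0%R.
have sizeL : size L = n.+1.
  rewrite size_cat size_flatten /shape -map_comp size_nseq sumnE big_map.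
  rewrite (eq_bigr c) => [|k _]; last by rewrite /= size_nseq.
  by rewrite -[m in iota _ m]subn0 big_mkord subnKC.
pose x k := nth 0%R L k; exists x.
(* The transport plan has [m + m] atoms: the first [m] keep mass [q k] in place at [y k], the last
   [m] carry the excess [p k - q k] from [y k] to [0]. *)
pose w k := (if (k < m)%N then q k else p (k - m)%N - q (k - m)%N)%R.
pose z k := if (k < m)%N then (y k : E, y k : E) else (y (k - m)%N : E, 0%R : E).
have sumw (h : E * E -> R) : (\sum_(k < m + m) w k * h (z k) =
    \sum_(k < m) q k * h (y k : E, y k : E) +
    \sum_(k < m) (p k - q k) * h (y k : E, 0))%R.
  rewrite big_split_ord /=; congr (_ + _)%R; apply: eq_bigr => k _.
    by rewrite /w /z ltn_ord.
  by rewrite /w /z ltnNge leq_addr /= addKn.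
have w0 k : (0 <= w k)%R by rewrite /w; case: ifP => // _; rewrite subr_ge0.
have w1 : (\sum_(k < m + m) w k = 1)%R.
  under eq_bigr do rewrite -[w _]mulr1.
  rewrite (sumw (fun=> 1%R)) -big_split /= -[RHS]p1; apply: eq_bigr => k _.
  by rewrite !mulr1 subrKC.
have [P Pd] := discrete_ex (z : nat -> borel (E * E)%type) w0 w1.
have -> : (n.+1%:R^-1 * \sum_(k < m) `|y k : E| =
   \sum_(k < m) n.+1%:R^-1 * `|y k : E|)%R by rewrite mulr_sumr.
apply: (@le_trans _ _ (\int[P]_z `|(z : E * E).1 - (z : E * E).2|%:E)); last first.
  rewrite (discrete_integral Pd)//; last exact: measurable_dist_borel.
  rewrite lee_fin (sumw (fun z : E * E => `|z.1 - z.2|%R)) /=.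
  rewrite big1 ?add0r => [|k _]; last by rewrite subrr normr0 mulr0.
  by apply: ler_sum => k _; rewrite subr0 ler_wpM2r.
apply: (@wasserstein_le _ (borel (E * E)%type) P nu _ fst snd).
- exact: (discrete_P1 nud).1.
- exact: (discrete_P1 (discrete_uniform_atoms n x)).1.
- rewrite (_ : (fun t => _) = id); first exact: measurable_id.
  by apply/funext => -[].
- move=> B mB; rewrite nuE// Pd.2; last first.
    by rewrite -[_ @^-1` _]setTI; exact: measurable_fst_borel.
  congr EFin; rewrite (sumw (\1_(fst @^-1` B))) -big_split /=.
  by apply: eq_bigr => k _; rewrite -mulrDl subrKC.
- move=> B mB; rewrite (discrete_uniform_atoms n x).2// Pd.2; last first.
    by rewrite -[_ @^-1` _]setTI; exact: measurable_snd_borel.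
  congr EFin; rewrite (sumw (\1_(snd @^-1` B))) -mulr_sumr.
  have -> : (\sum_(k < n.+1) \1_B (x k : borel E) =
      \sum_(v <- L) \1_B (v : borel E) :> R)%R.
    by rewrite [RHS](big_nth 0%R) sizeL big_mkord.
  rewrite sum_seq_atoms mulrDr mulr_sumr; congr (_ + _)%R.
    by apply: eq_bigr => k _; rewrite mulrA [(_^-1 * _)%R]mulrC.
  (* The total excess is [l / n.+1], which is the mass of the padding atoms at [0]. *)
  rewrite mulrA -[LHS]/(\sum_(k < m) (p k - q k) * \1_B (0 : borel E))%R.
  rewrite -mulr_suml; congr (_ * _)%R.
  rewrite sumrB p1 /q -mulr_suml natrB// natr_sum mulrBr mulVf ?gt_eqF//.
  by rewrite [(_^-1 * _)%R]mulrC.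
Qed.

Lemma le_of_le_mulVn (a b : R) : (forall n, a <= n.+1%:R^-1 * b)%R -> (a <= 0)%R.
Proof.
move=> ab; rewrite leNgt; apply/negP => a0.
have b0 : (0 < b)%R by rewrite (lt_le_trans a0)// (le_trans (ab 0%N))// invr1 mul1r.
have [n] := @ltr_add_invr R 0 (a / b)%R (divr_gt0 a0 b0); rewrite add0r ltr_pdivlMr//.
by rewrite ltNge ab.
Qed.

(** Both maps are 1-Lipschitz, so their gap changes by at most twice the Wasserstein distance. It
    vanishes on uniform measures, hence on discrete ones, hence on [P1]. *)
Lemma arithmetic_barycentric_unique (b b' : probability (borel E) R -> E) :
  arithmetic_barycentric b -> arithmetic_barycentric b' ->
  forall mu, P1 mu -> b mu = b' mu.
Proof.
move=> [[_ bW] bA] [[_ b'W] b'A].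
have close mu nu (e : R) : P1 mu -> P1 nu -> wasserstein mu nu <= e%:E ->
    (`|b mu - b' mu| <= `|b nu - b' nu| + (e + e))%R.
  move=> P1mu P1nu We.
  have := le_trans (bW _ _ P1mu P1nu) We; rewrite lee_fin.
  have := le_trans (b'W _ _ P1mu P1nu) We; rewrite lee_fin distrC.
  have := ler_distD (b nu) (b mu) (b' mu).
  have := ler_distD (b' nu) (b nu) (b' mu).
  lra.
have eqd m p y nu : discrete m p y nu -> b nu = b' nu.
  move=> nud; apply/eqP; rewrite -subr_eq0 -normr_le0.
  apply: (@le_of_le_mulVn _ (\sum_(k < m) `|y k : E| + \sum_(k < m) `|y k : E|)%R) => n.
  have [x Wx] := discrete_near_uniform n nud.
  have := close _ _ _ (discrete_P1 nud) (discrete_P1 (discrete_uniform_atoms n x)) Wx.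
  by rewrite bA b'A subrr normr0 add0r -mulrDr.
move=> mu P1mu; apply/eqP; rewrite -subr_eq0 -normr_le0.
apply: (@le_of_le_mulVn _ 2%R) => n.
have [|m [p [y [nu [nud W]]]]] := @P1_near_discrete mu (n.+1%:R^-1)%R P1mu.
  by rewrite invr_gt0.
have := close _ _ _ P1mu (discrete_P1 nud) W.
by rewrite (eqd _ _ _ _ nud) subrr normr0 add0r mulr_natr mulr2n.
Qed.

End density.

Theorem proposition3p11 (R : realType) (d : measure_display)
    (A : measurableType d) (mu : probability A R)
    (E : completeNormedModType R) (f : {mfun A >-> borel E}) :
  (bochner_integrable mu (f : A -> E) <-> P1 (distribution mu f)) /\
  (bochner_integrable mu (f : A -> E) ->
     bochner_integral mu (f : A -> E) = arithmetic_barycenter (distribution mu f)).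
Proof.
have mf : measurable_fun setT (f : A -> borel E) by [].
have fE (B : set (borel E)) : measurable B -> mu (f @^-1` B) = distribution mu f B by [].
have mid := @measurable_id _ (borel E) setT.
have fP1 : bochner_integrable mu (f : A -> E) -> P1 (distribution mu f).
  exact: bochner_integrable_P1 fE.
(* With the identity of [E] as integrand, change of variables along [f] carries integrability from
   [distribution mu f] to [mu]. *)
split; first split=> // /P1_integrable_id idf.
  exact: (bochner_integral_comp mf fE mid idf).1.
move=> /fP1 P1f.
rewrite (bochner_integral_comp mf fE mid (P1_integrable_id P1f)).2.
(* As some arithmetic barycentric map exists, [arithmetic_barycenter] is one; uniqueness on [P1]
   equates it with the integral of the identity. *)
apply: (arithmetic_barycentric_unique (bochner_integral_arithmetic E) _ P1f).
apply: (@xgetPex _ _ [set b | @arithmetic_barycentric R E b]).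
by eexists; exact: bochner_integral_arithmetic.
Qed.
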